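(* Let $d\geq 1$ and $L\geq 2$ be integers and let $\mathcal{L}:\mathbb{R}^d\to\mathbb{R}$ be differentiable. Let $\theta\in\mathbb{R}^d$ be parameterized as $\theta=\bigodot_{j=1}^L u^j$, where $u^1,\dots,u^L:[0,+\infty)\to\mathbb{R}^d$ follow the gradient flow dynamic $$\forall j\in[L],\ \forall t\geq 0,\qquad \frac{du^j(t)}{dt}+\Big(\bigodot_{k\neq j}u^k(t)\Big)\odot\nabla\mathcal{L}(\theta(t))=0,\qquad \theta(t)=\bigodot_{j=1}^L u^j(t).$$ Assume that the initialization satisfies: for every $i\in[d]$, the set $\arg\min_{k\in[L]}|u^k_i(0)|$ has exactly one element. Then $\theta$ follows a mirror flow dynamic, i.e. there exists a convex Legendre function $\mathcal{Q}:\mathbb{R}^d\to\mathbb{R}$ such that $$\forall t\geq 0,\qquad \frac{d\nabla\mathcal{Q}(\theta(t))}{dt}+\nabla\mathcal{L}(\theta(t))=0.$$ In particular, for $t>0$, $$\mathcal{L}(\theta(t))-\mathcal{L}^*\leq\frac{D_{\mathcal{Q}}(\theta^*,\theta(0))}{t},$$ where $\theta^*\in\arg\min_{\theta\in\mathbb{R}^d}\mathcal{L}(\theta)$, $\mathcal{L}^*=\min_{\theta\in\mathbb{R}^d}\mathcal{L}(\theta)$ and $D_{\mathcal{Q}}(\theta^*,\theta)=\mathcal{Q}(\theta^* )-\mathcal{Q}(\theta)-\langle\nabla\mathcal{Q}(\theta),\theta^*-\theta\rangle$.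
   Context: Notation: $[L]=\{1,\dots,L\}$; $u^j_i$ is the $i$-th component of $u^j$; $\odot$ is the Hadamard (componentwise) product on $\mathbb{R}^d$, and $\bigodot_{j}u^j$ is the vector with $i$-th component $\prod_j u^j_i$. The system is the Euclidean gradient flow of $(u^1,\dots,u^L)\mapsto\mathcal{L}\big(\bigodot_{j=1}^L u^j\big)$ (training of an $L$-layer deep diagonal linear network). The integer $L$ (number of layers) is distinct from the loss function $\mathcal{L}$. A convex Legendre function is, in the usual sense, a proper closed convex function that is essentially smooth and strictly convex on the interior of its domain; for a finite-valued function on all of $\mathbb{R}^d$ this means differentiable and strictly convex on $\mathbb{R}^d$.
   Formalization: The convergence rate is stated only for convex loss: without convexity it fails for a constant flow at a non-global local minimiser; existence of the Legendre function and the mirror flow identity are kept for every differentiable loss. *)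

(* Defs.v *)
From HB Require Import structures.
From mathcomp Require Import all_boot all_order all_algebra.
From mathcomp Require Import all_classical all_reals all_analysis.

Set Implicit Arguments.
Unset Strict Implicit.
Unset Printing Implicit Defensive.

Import Order.TTheory GRing.Theory Num.Theory.
Import numFieldNormedType.Exports.

Local Open Scope classical_set_scope.
Local Open Scope ring_scope.

Definition hadamard (R : realType) (d : nat) (x y : 'rV[R]_d) : 'rV[R]_d :=
  map2_mx *%R x y.

Definition hadamard_prod (R : realType) (d L : nat) (P : pred 'I_L)
    (u : 'I_L -> 'rV[R]_d) : 'rV[R]_d :=
  \row_i \prod_(j | P j) u j 0 i.

Definition dotr (R : realType) (d : nat) (x y : 'rV[R]_d) : R :=
  \sum_i x 0 i * y 0 i.

(* The vector of partial derivatives; it represents the differential of f at x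
   only where f is differentiable. *)
Definition grad (R : realType) (d : nat) (f : 'rV[R]_d -> R) (x : 'rV[R]_d) :
    'rV[R]_d :=
  \row_i 'D_(delta_mx 0 i) f x.

(* f has derivative l at t along [0, +oo[: the usual two-sided derivative if
   t > 0 and the right derivative if t = 0. The values of f at negative times
   play no role. *)
Definition is_time_derivative (R : realType) (d : nat) (f : R -> 'rV[R]_d)
    (t : R) (l : 'rV[R]_d) : Prop :=
  (s - t)^-1 *: (f s - f t) @[s --> within [set s | 0 <= s] t^'] --> l.

Definition argmin (R : realType) (T : Type) (f : T -> R) : set T :=
  [set x | forall y, f x <= f y].

Definition strictly_convex (R : realType) (d : nat) (f : 'rV[R]_d -> R) : Prop :=
  forall (x y : 'rV[R]_d) (t : R), x != y -> 0 < t -> t < 1 ->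
    f (t *: x + (1 - t) *: y) < t * f x + (1 - t) * f y.

(* Convex Legendre functions (proper, closed, convex, essentially smooth,
   strictly convex on the interior of the domain) that are finite on the whole
   space: the domain has no boundary, so that essential smoothness is
   differentiability everywhere, and properness and closedness are automatic. *)
Definition legendre (R : realType) (d : nat) (Q : 'rV[R]_d -> R) : Prop :=
  (forall x, differentiable Q x) /\ strictly_convex Q.

Definition bregman (R : realType) (d : nat) (Q : 'rV[R]_d -> R)
    (x y : 'rV[R]_d) : R :=
  Q x - Q y - dotr (grad Q y) (x - y).

Definition gradient_flow (R : realType) (d L : nat) (loss : 'rV[R]_d -> R)
    (u : 'I_L -> R -> 'rV[R]_d) (theta : R -> 'rV[R]_d) : Prop :=
  forall (j : 'I_L) (t : R), 0 <= t ->
    is_time_derivative (u j) t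
      (- hadamard (hadamard_prod (fun k => k != j) (fun k => u k t))
                  (grad loss (theta t))).

Definition mirror_flow (R : realType) (d : nat) (loss Q : 'rV[R]_d -> R)
    (theta : R -> 'rV[R]_d) : Prop :=
  forall t : R, 0 <= t ->
    is_time_derivative (fun s => grad Q (theta s)) t (- grad loss (theta t)).

(* Main.v *)
(* Fix a coordinate i, with g the i-th partial derivative of the loss along
   theta. Since (u^j_i)' u^j_i = - theta_i g for every j, the differences
   (u^j_i)^2 - (u^k_i)^2 are conserved. Let v = u^{k0}_i be the coordinate of
   smallest initial modulus and a_j = u^j_i(0)^2 - v(0)^2 > 0 for j <> k0. Then
   u^j_i never vanishes for j <> k0, so that, for a constant sign sg,
     theta_i = sg phi(v), phi(v) = v r(v), r(v) = \prod_(j <> k0) sqrt (v^2 + a_j),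
   and v' = - sg r(v) g. With p' = 1 / r, the quantity sg p(v) has derivative
   - g, and it is q(theta_i) for the continuous increasing function
   q(x) = sg p(phi^-1(sg x)). So Q(x) = \sum_i Q_i(x_i) with Q_i' = q_i.

   For the rate, t (loss(theta(t)) - loss(theta* )) + D_Q(theta*, theta(t)) is
   nonincreasing, because the loss decreases along theta and, by convexity, lies
   above its tangents. *)

Require Import Defs.
From mathcomp Require Import all_boot all_order all_algebra.
From mathcomp Require Import all_classical all_reals all_analysis.
From mathcomp Require Import ring lra.
Import Order.TTheory GRing.Theory Num.Theory.
Import numFieldNormedType.Exports.
Local Open Scope classical_set_scope.
Local Open Scope ring_scope.

(** * Calculus on the real line *)

Lemma is_derive_continuous (R : realType) (f : R -> R) (x l : R) :
  is_derive x 1 f l -> {for x, continuous f}.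
Proof. by move=> [df _]; exact/differentiable_continuous/derivable1_diffP. Qed.

(** With base point -1 the fundamental theorem of calculus covers every [x >= 0]; around [x < 0] the
    integrand is zero on the whole interval, so the integral is locally constant. *)
Lemma vanishing_antiderivative (R : realType) (h : R -> R) :
  continuous h -> (forall x, x <= 0 -> h x = 0) ->
  exists H : R -> R, forall x : R, is_derive x 1 H (h x).
Proof.
move=> ch h0.
pose H x := (\int[lebesgue_measure]_(t in `[-1, x]) h t)%R.
exists H => x; have [x0|x0] := ltP x 0.
  rewrite h0 ?ltW//; apply: (@near_eq_is_derive _ _ _ (cst 0)) => //.
  near=> y; rewrite /H (@eq_Rintegral _ _ _ _ _ (cst 0)).
    by rewrite Rintegral_cst ?mul0r.
  move=> t; rewrite inE /= in_itv /= => /andP[_ ty]; apply: h0.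
  rewrite (le_trans ty)//; apply: ltW; near: y; exact: lt_nbhsl.
have [] := @continuous_FTC1_closed R h (-1) x (x + 1) _ _ _ (ch x).
- by rewrite ltrDl.
- apply: continuous_compact_integrable; first exact: segment_compact.
  exact: continuous_subspaceT.
- by rewrite (lt_le_trans _ x0)// ltrN10.
- move=> dH HE; apply: DeriveDef; first exact: dH.
  by rewrite -derive1E; exact: HE.
Unshelve. all: by end_near. Qed.

Lemma continuous_antiderivative (R : realType) (f : R -> R) :
  continuous f -> exists F : R -> R, forall x : R, is_derive x 1 F (f x).
Proof.
move=> cf.
(* f x = f 0 + (f (max x 0) - f 0) + (f (min x 0) - f 0), and each difference
   vanishes on a half-line, so that it has an integral with a fixed endpoint. *)
have cm : continuous (fun y : R => Num.max y 0).
  move=> x; apply: (@continuous_max _ _ id (cst 0)); first exact: cvg_id.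
  exact: cvg_cst.
have c1 : continuous (fun x : R => f (Num.max x 0) - f 0).
  move=> x; apply: cvgB; last exact: cvg_cst.
  exact: (cvg_comp _ _ (cm x) (cf _)).
have c2 : continuous (fun x : R => f (- Num.max x 0) - f 0).
  move=> x; apply: cvgB; last exact: cvg_cst.
  exact: (cvg_comp _ _ (cvgN (cm x)) (cf _)).
have [x x0|F1 dF1] := vanishing_antiderivative _ _ c1.
  by rewrite max_r// subrr.
have [x x0|F2 dF2] := vanishing_antiderivative _ _ c2.
  by rewrite max_r// oppr0 subrr.
(* [F2] integrates the reflected negative part of [f], so it enters at [- x], and the minus sign
   compensates the chain rule. *)
exists (fun x => F1 x - F2 (- x) + f 0 * x) => x.
have d2 := @is_derive1_comp R F2 (fun y => - y) x _ _ (dF2 (- x))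
             (is_deriveNid x 1).
apply: (is_derive_eq (is_deriveD (is_deriveB (dF1 x) d2)
  (is_deriveZ (f 0) (is_derive_id x 1)))).
rewrite /GRing.scale /=.
have [x0|x0] := leP x 0.
  rewrite max_l ?oppr_ge0// opprK; ring.
rewrite max_r ?oppr_le0 ?ltW// oppr0; ring.
Qed.

Lemma is_derive_MVT (R : realType) (f df : R -> R) (a b : R) : a < b ->
  (forall x : R, is_derive x 1 f (df x)) ->
  exists2 c, a < c < b & f b - f a = df c * (b - a).
Proof.
move=> ab fdf; have fc : {within `[a, b], continuous f}.
  by apply: continuous_subspaceT => x; exact: is_derive_continuous (fdf x).
have [c cab E] := MVT ab (fun x _ => fdf x) fc.
by exists c => //; rewrite !(itvP cab).
Qed.

Lemma is_derive_gt0_incr (R : realType) (f df : R -> R) :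
  (forall x : R, is_derive x 1 f (df x)) -> (forall x, 0 < df x) ->
  {homo f : x y / x < y}.
Proof.
move=> fdf df0 x y xy; have [c _ E] := is_derive_MVT _ _ _ _ _ xy fdf.
by rewrite -subr_gt0 E mulr_gt0// subr_gt0.
Qed.

(** By the mean value theorem the gap is a difference of two slopes times an increment, and both
    factors have the same sign. *)
Lemma tangent_below (R : realType) (f df : R -> R) :
  (forall x : R, is_derive x 1 f (df x)) -> {homo df : x y / x < y} ->
  forall x y, y != x -> 0 < f y - f x - df x * (y - x).
Proof.
move=> fdf dfi x y; rewrite neq_lt => /orP[yx|xy].
- have [c /andP[yc cx] E] := is_derive_MVT _ _ _ _ _ yx fdf.
  have -> : f y - f x - df x * (y - x) = (df x - df c) * (x - y).
    by rewrite -(opprB (f x)) E; ring.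
  by rewrite mulr_gt0// subr_gt0// dfi.
- have [c /andP[xc cy] ->] := is_derive_MVT _ _ _ _ _ xy fdf.
  by rewrite -mulrBl mulr_gt0// subr_gt0// dfi.
Qed.

Lemma increasing_bijection_inverse (R : realType) (f : R -> R) :
  continuous f -> {homo f : x y / x < y} -> (forall y, exists x, f x = y) ->
  exists g : R -> R,
    [/\ cancel f g, continuous g & {homo g : x y / x < y}].
Proof.
move=> cf fi fs.
have [g gK] := choice fs.
have fK : cancel f g.
  move=> x; apply/eqP; rewrite eq_le !leNgt.
  by apply/andP; split; apply/negP => /fi; rewrite gK ltxx.
exists g; split => //.
- move=> y.
  have fK' : {near g y, cancel f g} by near=> x; exact: fK.
  have cf' : {near g y, continuous f} by near=> x; exact: cf.
  by have := nbhs_singleton (near_can_continuous fK' cf'); rewrite gK.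
- move=> x y xy; rewrite ltNge; apply/negP; rewrite le_eqVlt => /orP[/eqP|/fi].
    by move=> /(congr1 f); rewrite !gK => E; rewrite E ltxx in xy.
  by rewrite !gK => /(lt_trans xy); rewrite ltxx.
Unshelve. all: by end_near. Qed.

(** * Inverting [v * r v] for an even positive profile [r] *)

Section mirror_map.
Variables (R : realType) (r : R -> R).
Hypotheses (r_cont : continuous r) (r_gt0 : forall v, 0 < r v)
  (r_even : forall v, r (- v) = r v)
  (r_ndecr : forall v w, 0 <= v -> v <= w -> r v <= r w).

Let phi v := v * r v.

Let phi_cont : continuous phi.
Proof. by move=> v; apply: cvgM; [exact: cvg_id|exact: r_cont]. Qed.

Let phi_odd v : phi (- v) = - phi v.
Proof. by rewrite /phi r_even mulNr. Qed.

Let phi_incr_ge0 v w : 0 <= v -> v < w -> phi v < phi w.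
Proof.
move=> v0 vw; rewrite /phi (@le_lt_trans _ _ (v * r w))//.
  by rewrite ler_wpM2l// r_ndecr// ltW.
by rewrite ltr_pM2r.
Qed.

Let phi_incr : {homo phi : v w / v < w}.
Proof.
move=> v w vw; have [v0|v0] := leP 0 v; first exact: phi_incr_ge0.
have [w0|w0] := leP w 0.
  by rewrite -ltrN2 -!phi_odd phi_incr_ge0 ?oppr_ge0// ltrN2.
by rewrite (@lt_trans _ _ 0)// /phi ?pmulr_llt0// pmulr_lgt0.
Qed.

Let phi_surj_ge0 y : 0 <= y -> exists v, phi v = y.
Proof.
(* Since [r] is at least [r 0] on the right half-line, [phi (y / r 0) >= y]: this is the right
   endpoint for the intermediate value theorem. *)
move=> y0; pose b := y / r 0.
have b0 : 0 <= b by rewrite divr_ge0// ltW.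
have yb : y <= phi b.
  rewrite /phi (@le_trans _ _ (b * r 0))//; first by rewrite divfK// gt_eqF.
  by rewrite ler_wpM2l// r_ndecr.
have phic : {within `[0, b], continuous phi} by exact: continuous_subspaceT.
have phi0 : phi 0 = 0 by rewrite /phi mul0r.
have [|c _ <-] := IVT (v := y) b0 phic; last by exists c.
by rewrite phi0 ge_min le_max y0 yb orbT.
Qed.

Let phi_surj y : exists v, phi v = y.
Proof.
have [/phi_surj_ge0//|y0] := leP 0 y.
have [|v E] := @phi_surj_ge0 (- y); first by rewrite oppr_ge0 ltW.
by exists (- v); rewrite phi_odd E opprK.
Qed.

Lemma mirror_map (sg : R) : sg = 1 \/ sg = -1 -> exists q p : R -> R,
  [/\ continuous q, {homo q : x y / x < y},
      forall v, q (sg * (v * r v)) = sg * p v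
    & forall v : R, is_derive v 1 p (r v)^-1].
Proof.
move=> sg1.
have [|p dp] := @continuous_antiderivative R (fun v => (r v)^-1).
  by move=> v; apply: cvgV; [rewrite gt_eqF|exact: r_cont].
have [g [phiK g_cont g_incr]] :=
  increasing_bijection_inverse _ _ phi_cont phi_incr phi_surj.
have p_incr : {homo p : v w / v < w}.
  by apply: is_derive_gt0_incr dp _ => v; rewrite invr_gt0.
(* [g] inverts [phi] and [sg] is its own inverse; having [sg] both inside and outside keeps the
   function increasing when [sg = -1]. *)
exists (fun x => sg * p (g (sg * x))), p; split => //.
- move=> x; apply: cvgM; first exact: cvg_cst.
  have cx : {for x, continuous (fun x : R => sg * x)}.
    by apply: cvgM; [exact: cvg_cst|exact: cvg_id].
  apply: (cvg_comp _ _ (cvg_comp _ _ cx (g_cont _))).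
  exact: is_derive_continuous (dp _).
- move=> x y xy; case: sg1 => ->; first by rewrite !mul1r; exact/p_incr/g_incr.
  by rewrite !mulN1r ltrN2; apply/p_incr/g_incr; rewrite ltrN2.
- move=> v; rewrite mulrA; have -> : sg * sg = 1 by case: sg1 => ->; lra.
  by rewrite mul1r phiK.
Qed.

End mirror_map.

(** * One-sided time derivatives *)

(* Continues f linearly to negative times, so that a derivative along
   [0, +oo[ becomes a two-sided one. *)
Definition extend_left (R : realType) (f : R -> R) (l s : R) : R :=
  if s < 0 then f 0 + s * l else f s.

Lemma extend_leftE (R : realType) (f : R -> R) (l s : R) :
  0 <= s -> extend_left R f l s = f s.
Proof. by move=> s0; rewrite /extend_left ltNge s0. Qed.

Lemma is_derive1_dnbhsP (R : realType) (f : R -> R) (t l : R) :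
  is_derive t 1 f l <-> (s - t)^-1 * (f s - f t) @[s --> t^'] --> l.
Proof.
split=> [[df dfE]|dfl].
- have {df dfE} dfl :
      h^-1 *: ((f \o shift t) (h *: 1) - f t) @[h --> 0^'] --> l.
    by rewrite -dfE; exact: df.
  apply/cvgrPdist_lt => e e0; move/cvgrPdist_lt: dfl => /(_ e e0)[/= d d0 dl].
  exists d => //= s sd st; have := dl (s - t).
  rewrite /= sub0r normrN distrC subr_eq0 => /(_ sd st).
  by rewrite [_ *: 1]mulr1 subrK.
- have {}dfl : h^-1 *: ((f \o shift t) (h *: 1) - f t) @[h --> 0^'] --> l.
    apply/cvgrPdist_lt => e e0; move/cvgrPdist_lt: dfl => /(_ e e0)[/= d d0 dl].
    exists d => //= h; rewrite /= sub0r normrN => hd h0; have := dl (h + t).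
    rewrite /= opprD addrCA subrr addr0 normrN [_ *: 1]mulr1 addrK; apply => //.
    by rewrite -subr_eq0 addrK.
  by apply: DeriveDef; [apply/cvg_ex; exists l|exact: cvg_lim].
Qed.

(** At [t = 0] the slope of the linear extension has to agree with the right derivative; at [t > 0]
    a neighbourhood of radius at most [t] avoids negative times. *)
Lemma is_derive_extend_left (R : realType) (f : R -> R) (l0 t l : R) :
  0 <= t -> (t = 0 -> l = l0) ->
  (s - t)^-1 * (f s - f t) @[s --> within [set s | 0 <= s] t^'] --> l ->
  is_derive t 1 (extend_left R f l0) l.
Proof.
move=> t0 ll0 dfl; apply/is_derive1_dnbhsP/cvgrPdist_lt => e e0.
move/cvgrPdist_lt: dfl => /(_ e e0)[/= d d0 dl].
have [t0'|tN0] := eqVneq t 0.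
  exists d => //= s sd st; have [s0|s0] := leP 0 s.
    by rewrite !extend_leftE//; exact: dl.
  rewrite (extend_leftE _ _ _ t)// /extend_left s0 t0' subr0 addrAC subrr add0r.
  by rewrite mulKf ?lt_eqF// ll0// subrr normr0.
exists (Num.min d t); first by rewrite /= lt_min d0 lt_neqAle eq_sym tN0.
move=> s /=; rewrite lt_min => /andP[sd st] sNt.
have s0 : 0 <= s.
  by have := le_lt_trans (ler_norm _) st; rewrite ltrBlDl ltrDr => /ltW.
by rewrite !extend_leftE//; exact: dl.
Qed.

Lemma is_derive_time_cvg (R : realType) (f F : R -> R) (t l : R) :
  0 <= t -> (forall s, 0 <= s -> f s = F s) -> is_derive t 1 F l ->
  (s - t)^-1 * (f s - f t) @[s --> within [set s | 0 <= s] t^'] --> l.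
Proof.
move=> t0 fF /is_derive1_dnbhsP dF; apply/cvgrPdist_lt => e e0.
move/cvgrPdist_lt: dF => /(_ e e0)[/= d d0 dl].
by exists d => //= s sd sNt s0; rewrite !fF//; exact: dl.
Qed.

Lemma is_time_derivativeP (R : realType) (d : nat) (f : R -> 'rV[R]_d) (t : R)
    (l : 'rV[R]_d) :
  is_time_derivative f t l <->
  forall i, (s - t)^-1 * (f s 0 i - f t 0 i)
    @[s --> within [set s | 0 <= s] t^'] --> l 0 i.
Proof.
split=> [fl i|fl].
- have -> : (fun s => (s - t)^-1 * (f s 0 i - f t 0 i)) =
      (fun M : 'rV[R]_d => M 0 i) \o (fun s => (s - t)^-1 *: (f s - f t)).
    by apply/funext => s; rewrite /= !mxE.
  exact: (cvg_comp _ _ fl (@coord_continuous R 1 d 0 i l)).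
- apply/cvgrPdist_le => e e0; near=> s.
  rewrite /Num.Def.normr/= mx_normrE (bigmax_le _ (ltW e0))// => -[j i] _.
  rewrite !mxE (ord1 j) /=; move: i {j}.
  near: s; apply: filter_forall => i.
  exact: (cvgrPdist_le _ _).1 (fl i) _ e0.
Unshelve. all: by end_near. Qed.

Lemma is_derive_prod (R : realType) (I : finType) (w : I -> R -> R)
    (dw : I -> R) (t : R) : (forall i, is_derive t 1 (w i) (dw i)) ->
  is_derive t 1 (fun s => \prod_i w i s)
    (\sum_i dw i * \prod_(k | k != i) w k t).
Proof.
move=> wd.
(* The induction runs over duplicate-free sequences, so that the condition [k != i] removes exactly
   one factor. *)
suff H (s : seq I) : uniq s -> is_derive t 1 (fun x => \prod_(i <- s) w i x)
    (\sum_(i <- s) dw i * \prod_(k <- s | k != i) w k t).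
  exact: H (index_enum_uniq I).
elim: s => [_|a s IH /= /andP[aNs us]].
  rewrite big_nil (_ : (fun _ => _) = cst 1); first exact: is_derive_cst.
  by apply/funext => x; rewrite big_nil.
rewrite (_ : (fun _ => _) = w a * (fun x => \prod_(i <- s) w i x)); last first.
  by apply/funext => x; rewrite big_cons.
apply: (is_derive_eq (is_deriveM (wd a) (IH us))).
rewrite !big_cons eqxx /= addrC /GRing.scale /= mulrC; congr (_ * _ + _).
  rewrite [LHS]big_seq_cond [RHS]big_seq_cond; apply: eq_bigl => i.
  by rewrite andbT; case: eqVneq => [->|]; rewrite ?(negbTE aNs) ?andbT.
rewrite mulr_sumr; apply: eq_big_seq => i si.
rewrite big_cons; case: eqVneq => [E|_]; first by rewrite E si in aNs.
by rewrite mulrCA.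
Qed.

(** * The mirror map of one coordinate *)

Lemma continuous_prod (R : realType) (I : Type) (s : seq I) (P : pred I)
    (f : I -> R -> R) (x : R) : (forall i, {for x, continuous (f i)}) ->
  {for x, continuous (fun y => \prod_(i <- s | P i) f i y)}.
Proof.
move=> cf; elim: s => [|a s IH].
  rewrite (_ : (fun _ => _) = cst 1); first exact: cst_continuous.
  by apply/funext => y; rewrite big_nil.
rewrite (_ : (fun _ => _) = fun y =>
    (if P a then f a y else 1) * \prod_(i <- s | P i) f i y); last first.
  by apply/funext => y; rewrite big_cons; case: ifP; rewrite ?mul1r.
apply: cvgM; last exact: IH.
by case: (P a); [exact: cf|exact: cvg_cst].
Qed.

Lemma is_derive0_cst_ge0 (R : realType) (f : R -> R) :
  (forall s : R, 0 <= s -> is_derive s 1 f 0) -> forall t, 0 <= t -> f t = f 0.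
Proof.
move=> df t t0.
have [||c _ /eqP] := @MVT_segment R f (fun=> 0) 0 t t0.
- by move=> x; rewrite in_itv /= => /andP[/ltW x0 _]; exact: df.
- apply: derivable_within_continuous => x; rewrite in_itv /= => /andP[x0 _].
  by have [] := df x x0.
- by rewrite mul0r subr_eq0 => /eqP.
Qed.

(** The value of [q] along the product is exposed as a separate function [P] because [q] is known
    only to be continuous: the derivative comes from the explicit form [sg * p (w k0 t)] of [P], not
    from a chain rule through [q]. *)
Lemma coordinate_mirror (R : realType) (I : finType) (w : I -> R -> R)
    (g : R -> R) (k0 : I) :
  (forall j (t : R), 0 <= t ->
     is_derive t 1 (w j) (- ((\prod_(k | k != j) w k t) * g t))) ->
  (forall j, j != k0 -> `|w k0 0| < `|w j 0|) ->
  exists q P : R -> R,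
  [/\ continuous q, {homo q : x y / x < y},
      forall t, 0 <= t -> q (\prod_j w j t) = P t
    & forall t : R, 0 <= t -> is_derive t 1 P (- g t)].
Proof.
move=> dw wmin.
pose a j := w j 0 ^+ 2 - w k0 0 ^+ 2.
have a_gt0 j : j != k0 -> 0 < a j.
  move=> /wmin wj; rewrite subr_gt0 -real_normK ?num_real//.
  by rewrite -(real_normK (num_real (w j 0))) ltrXn2r.
pose r v := \prod_(j | j != k0) Num.sqrt (v ^+ 2 + a j).
have ra_gt0 v j : j != k0 -> 0 < v ^+ 2 + a j.
  by move=> /a_gt0 aj; rewrite ltr_wpDl// sqr_ge0.
have r_gt0 v : 0 < r v.
  by apply: prodr_gt0 => j jk; rewrite sqrtr_gt0 ra_gt0.
have r_cont : continuous r.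
  move=> v; apply: continuous_prod => j.
  apply: (@cvg_comp _ _ _ (fun v : R => v ^+ 2 + a j) Num.sqrt); last first.
    exact: sqrt_continuous.
  by apply: cvgD; [exact: exprn_continuous|exact: cvg_cst].
have r_even v : r (- v) = r v by apply: eq_bigr => j _; rewrite sqrrN.
have r_ndecr v v' : 0 <= v -> v <= v' -> r v <= r v'.
  move=> v0 vv'; apply: ler_prod => j _; rewrite sqrtr_ge0 /=.
  by rewrite ler_wsqrtr// lerD2r lerXn2r// nnegrE (le_trans v0).
have conserved j t : 0 <= t -> w j t ^+ 2 = w k0 t ^+ 2 + a j.
  move=> t0; suff : w j t * w j t - w k0 t * w k0 t = a j.
    by rewrite -!expr2 => <-; rewrite addrC subrK.
  rewrite /a !expr2.
  apply: (@is_derive0_cst_ge0 R (w j * w j - w k0 * w k0)) => // s s0.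
  apply: (is_derive_eq (is_deriveB (is_deriveM (dw j s s0) (dw j s s0))
    (is_deriveM (dw k0 s s0) (dw k0 s s0)))).
  have E i : w i s * \prod_(k | k != i) w k s = \prod_k w k s.
    by rewrite [RHS](bigD1 i).
  rewrite /GRing.scale /= !mulrN !mulrA !E; ring.
pose W t := \prod_(j | j != k0) w j t.
have W_norm t : 0 <= t -> `|W t| = r (w k0 t).
  move=> t0; rewrite normr_prod; apply: eq_bigr => j jk.
  by rewrite -conserved// sqrtr_sqr.
have W_neq0 t : 0 <= t -> W t != 0.
  by move=> t0; rewrite -normr_eq0 W_norm// gt_eqF.
(* A change of sign would force a zero of the continuous function [W] between 0 and [t], whereas [W]
   never vanishes at nonnegative times. *)
have W_sg t : 0 <= t -> Num.sg (W t) = Num.sg (W 0).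
  move=> t0; apply/eqP/negPn/negP => Wsg.
  have Wc : {within `[0, t], continuous W}.
    apply: continuous_in_subspaceT => s; rewrite inE /= in_itv /=.
    move=> /andP[s0 _]; apply: continuous_prod => j.
    exact: is_derive_continuous (dw j s s0).
  have [|c] := IVT (v := 0) t0 Wc.
    rewrite ge_min le_max.
    have := W_neq0 _ t0; have := W_neq0 _ (lexx 0); move: Wsg.
    case: (sgrP (W t)); case: (sgrP (W 0)); rewrite ?eqxx// => H1 H2 _ _ _;
      by rewrite ?(ltW H1) ?(ltW H2) ?orbT.
  rewrite in_itv /= => /andP[c0 _] /eqP; apply/negP; exact: W_neq0.
pose sg := Num.sg (W 0).
have sg1 : sg = 1 \/ sg = -1.
  rewrite /sg; have := W_neq0 _ (lexx 0).
  by case: sgrP => //; [left|right].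
have WE t : 0 <= t -> W t = sg * r (w k0 t).
  by move=> t0; rewrite -W_norm// /sg -(W_sg t)// mulr_sg_norm.
have [q [p [q_cont q_incr qp dp]]] :=
  mirror_map R r r_cont r_gt0 r_even r_ndecr sg sg1.
exists q, (fun t => sg * p (w k0 t)); split => // t t0.
  by rewrite (bigD1 k0)//= -/(W t) WE// mulrCA qp.
(* The factor [1 / r] from the derivative of [p] cancels the [r] in [W = sg * r], and the two signs
   multiply to 1, which leaves [- g t]. *)
have dpw := @is_derive1_comp R p (w k0) t _ _ (dp _) (dw k0 t t0).
apply: (is_derive_eq (is_deriveZ sg dpw)).
rewrite /GRing.scale /= -/(W t) WE// -(mulrA sg) mulrN.
rewrite [_^-1 * _]mulrCA mulKf ?gt_eqF// mulrN mulrA.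
by case: sg1 => ->; rewrite ?mulrNN !mul1r.
Qed.

(** * Separable potentials *)

Section separable.
Variables (R : realType) (d : nat) (F f : 'I_d -> R -> R).
Hypothesis dF : forall i (x : R), is_derive x 1 (F i) (f i x).

Let Q (x : 'rV[R]_d) := \sum_i F i (x 0 i).

Lemma separable_differentiable x : differentiable Q x.
Proof.
have -> : Q = \sum_i (F i \o (fun x : 'rV[R]_d => x 0 i)).
  by apply/funext => y; rewrite fct_sumE.
apply: differentiable_sum => i; apply: differentiable_comp.
  exact: differentiable_coord.
by apply/derivable1_diffP; have [] := dF i (x 0 i).
Qed.

Lemma grad_separable x : grad Q x = \row_i f i (x 0 i).
Proof.
apply/rowP => i; rewrite !mxE.
have dQ : is_derive (0 : R) 1 (fun h => Q (h *: delta_mx 0 i + x))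
    (f i (x 0 i)).
  have -> : (fun h => Q (h *: delta_mx 0 i + x)) =
      \sum_j (F j \o (fun h => h * (j == i)%:R + x 0 j)).
    apply/funext => h; rewrite fct_sumE; apply: eq_bigr => j _.
    by rewrite /= !mxE eqxx.
  have dlin j : is_derive (0 : R) 1 (fun h : R => h * (j == i)%:R + x 0 j)
      (j == i)%:R.
    have -> : (fun h : R => h * (j == i)%:R + x 0 j) =
        (j == i)%:R *: id + cst (x 0 j).
      by apply/funext => h; rewrite mulrC.
    apply: (is_derive_eq (is_deriveD
      (is_deriveZ _ (is_derive_id (0 : R) (1 : R)))
      (is_derive_cst (x 0 j) (0 : R) (1 : R)))).
    by rewrite addr0 /GRing.scale /= mulr1.
  apply: (is_derive_eq
    (is_derive_sum (fun j => is_derive1_comp (dF j _) (dlin j)))).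
  rewrite (bigD1 i)//= eqxx mulr1 mul0r add0r big1 ?addr0// => j ji.
  by rewrite (negbTE ji) mulr0.
(* The partial derivative of [Q] at [x] and the derivative at 0 of its restriction to the line are
   limits of the same difference quotients. *)
rewrite -(@derive_val _ _ _ _ _ _ _ dQ) /derive.
set g1 := fun h => h^-1 *: _; set g2 := fun h => h^-1 *: _.
suff -> : g1 = g2 by [].
by apply/funext => h; rewrite /g2 /= addr0 scale0r add0r [_ *: 1]mulr1.
Qed.

Lemma bregman_separable x y : bregman Q y x =
  \sum_i (F i (y 0 i) - F i (x 0 i) - f i (x 0 i) * (y 0 i - x 0 i)).
Proof.
rewrite /bregman grad_separable /dotr /Q -!sumrB; apply: eq_bigr => i _.
by rewrite !mxE.
Qed.

Hypothesis f_incr : forall i, {homo f i : x y / x < y}.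

Lemma bregman_separable_gt0 x y : y != x -> 0 < bregman Q y x.
Proof.
move=> yx; rewrite bregman_separable.
have tangent i : y 0 i != x 0 i ->
    0 < F i (y 0 i) - F i (x 0 i) - f i (x 0 i) * (y 0 i - x 0 i).
  exact: (tangent_below _ _ _ (dF i) (f_incr i)).
have [i yxi] : exists i, y 0 i != x 0 i.
  apply/existsP; rewrite -negb_forall; apply: contra yx => /forallP yx.
  by apply/eqP/rowP => i; exact/eqP.
rewrite (bigD1 i)//= ltr_pwDl ?tangent// sumr_ge0// => j _.
have [->|/tangent/ltW//] := eqVneq (y 0 j) (x 0 j).
by rewrite !subrr mulr0 subr0.
Qed.

Lemma bregman_separable_ge0 x y : 0 <= bregman Q y x.
Proof.
have [->|/bregman_separable_gt0/ltW//] := eqVneq y x.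
by rewrite bregman_separable big1// => i _; rewrite !subrr mulr0 subr0.
Qed.

(** For strict convexity, weight the divergences of [x] and [y] from the convex combination [z] by
    [t] and [1 - t]: the gradient terms cancel, and the sum is positive because [x] differs from
    [z]. *)
Lemma separable_legendre : legendre Q.
Proof.
split=> [x|x y t xy t0 t1]; first exact: separable_differentiable.
set z := _ + _.
have zE i : z 0 i = t * x 0 i + (1 - t) * y 0 i by rewrite !mxE.
have xz : x != z.
  apply: contra_neq xy => xz; apply/rowP => i.
  have := zE i; rewrite -xz => E; have : (1 - t) * (x 0 i - y 0 i) = 0 by lra.
  by move/eqP; rewrite mulf_eq0 subr_eq0 gt_eqF//= subr_eq0 => /eqP.
have H1 : 0 < t * bregman Q x z by rewrite mulr_gt0// bregman_separable_gt0.
have H2 : 0 <= (1 - t) * bregman Q y z.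
  by rewrite mulr_ge0 ?bregman_separable_ge0// subr_ge0 ltW.
have H3 : t * dotr (grad Q z) (x - z) + (1 - t) * dotr (grad Q z) (y - z) = 0.
  rewrite /dotr !mulr_sumr -big_split big1//= => i _.
  by rewrite ![(_ - z) _ _]mxE ![(- z) _ _]mxE zE; ring.
by move: H1 H2 H3; rewrite /bregman; lra.
Qed.

End separable.

(** * Convergence rate of convex mirror flows *)

Lemma diff_dotr (R : realType) (d : nat) (f : 'rV[R]_d -> R) (x v : 'rV[R]_d) :
  differentiable f x -> 'd f x v = dotr (grad f x) v.
Proof.
move=> df; rewrite {1}(row_sum_delta v) linear_sum; apply: eq_bigr => i _.
by rewrite linearZ mxE deriveE// mulrC.
Qed.

(** Convexity bounds the difference quotients along [y - x] by [f y - f x] for steps between 0 and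
    1, so their limit at 0 obeys the same bound. *)
Lemma convex_gradient_le (R : realType) (d : nat) (f : 'rV[R]_d -> R)
    (x y : 'rV[R]_d) :
  differentiable f x -> convex_function [set: convex_lmodType 'rV[R]_d] f ->
  f x + dotr (grad f x) (y - x) <= f y.
Proof.
move=> df cf; rewrite -lerBrDl leNgt; apply/negP => lt_dot.
have := diff_derivable (v := y - x) df.
move=> /derivableP[+ _]; rewrite /derivable => dfv.
have {}dfv : h^-1 *: ((f \o shift x) (h *: (y - x)) - f x) @[h --> 0^'] -->
    dotr (grad f x) (y - x).
  by rewrite -diff_dotr// -deriveE//; exact: dfv.
move/cvgrPdist_lt: dfv.
move=> /(_ (dotr (grad f x) (y - x) - (f y - f x))); rewrite subr_gt0.
move=> /(_ lt_dot)[e /= e0 He].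
(* The step lies within the radius [e] given by the limit, and being at most 1 it can serve as a
   convex weight. *)
pose h := Num.min (e / 2) 1.
have h0 : 0 < h by rewrite /h lt_min ltr01 divr_gt0.
have h1 : h <= 1 by rewrite /h ge_min lexx orbT.
have he : h < e by rewrite /h gt_min; apply/orP; left; lra.
have := He h; rewrite /= sub0r normrN gtr0_norm// gt_eqF// => /(_ he isT).
move=> /(le_lt_trans (ler_norm _)); rewrite ltrD2l ltrN2.
rewrite -[f y - f x](mulKf (lt0r_neq0 h0)) /GRing.scale /= ltr_pM2l ?invr_gt0//.
have := cf (Itv01 (ltW h0) h1) y x (in_setT _) (in_setT _).
have -> : (conv (Itv01 (ltW h0) h1) (y : convex_lmodType 'rV[R]_d) x) =
    h *: (y - x) + x.
  rewrite -[LHS]/(h *: y + (1 - h) *: x) scalerBr scalerBl scale1r.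
  by rewrite addrA addrAC.
rewrite -[X in _ <= X]/(h * f y + (1 - h) * f x) => H1 H2.
by move: H1 H2; lra.
Qed.

Lemma is_derive_along (R : realType) (d : nat) (f : 'rV[R]_d -> R)
    (c dc : 'I_d -> R -> R) (t : R) :
  differentiable f (\row_i c i t) ->
  (forall i, is_derive t 1 (c i) (dc i t)) ->
  is_derive t 1 (fun s => f (\row_i c i s))
    (\sum_i grad f (\row_i c i t) 0 i * dc i t).
Proof.
move=> df dcd.
pose C s : 'rV[R]_d := \row_i c i s.
have C_coord i j : (fun s => C s i j) = c j by apply/funext => s; rewrite mxE.
have C_der : derivable C t 1.
  by apply/derivable_mxP => i j; rewrite C_coord; have [] := dcd j.
have C_diff : differentiable C t by exact/derivable1_diffP.
have fC_diff : differentiable (f \o C) t by exact: differentiable_comp.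
apply: DeriveDef; first exact/derivable1_diffP.
rewrite (@deriveE _ _ _ (f \o C))// diff_comp//= diff_dotr//.
apply: eq_bigr => i _; congr (_ * _).
by rewrite -deriveE// derive_mx// mxE C_coord; have [] := dcd i.
Qed.

Lemma mirror_flow_rate (R : realType) (d : nat) (loss : 'rV[R]_d -> R)
    (F f T P dT : 'I_d -> R -> R) (xstar : 'rV[R]_d) (t : R) :
  (forall x, differentiable loss x) ->
  convex_function [set: convex_lmodType 'rV[R]_d] loss ->
  (forall i (x : R), is_derive x 1 (F i) (f i x)) ->
  (forall i, {homo f i : x y / x < y}) ->
  (forall i (s : R), 0 <= s -> is_derive s 1 (T i) (dT i s)) ->
  (forall i (s : R), 0 <= s ->
    is_derive s 1 (P i) (- grad loss (\row_i T i s) 0 i)) ->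
  (forall i s, 0 <= s -> f i (T i s) = P i s) ->
  (forall i s, 0 <= s -> grad loss (\row_i T i s) 0 i * dT i s <= 0) ->
  0 < t ->
  loss (\row_i T i t) - loss xstar <=
    bregman (fun x : 'rV[R]_d => \sum_i F i (x 0 i)) xstar (\row_i T i 0) / t.
Proof.
move=> dloss closs dF f_incr Td Pd fT gT t0.
pose Q (x : 'rV[R]_d) := \sum_i F i (x 0 i).
pose Th s : 'rV[R]_d := \row_i T i s.
(* The divergence is written with [P i s] in place of [f i (T i s)]: they agree at nonnegative
   times, and [P] is the one with a known derivative. *)
pose B i s := F i (xstar 0 i) - F i (T i s) - P i s * (xstar 0 i - T i s).
have BE s : 0 <= s -> \sum_i B i s = bregman Q xstar (Th s).
  move=> s0; rewrite (bregman_separable _ _ _ _ dF); apply: eq_bigr => i _.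
  by rewrite !mxE fT.
pose E s := s * (loss (Th s) - loss xstar) + \sum_i B i s.
pose g i s := grad loss (Th s) 0 i.
pose dE s := (loss (Th s) - loss xstar) + s * (\sum_i g i s * dT i s)
  + \sum_i g i s * (xstar 0 i - T i s).
have Bd i (s : R) : 0 <= s -> is_derive s 1 (B i) (g i s * (xstar 0 i - T i s)).
  move=> s0.
  have d1 := is_derive1_comp (dF i (T i s)) (Td i s s0).
  have d2 := is_deriveB (is_derive_cst (xstar 0 i) s 1) (Td i s s0).
  have -> : B i = cst (F i (xstar 0 i)) - F i \o T i
                  - P i * (cst (xstar 0 i) - T i) by [].
  apply: (is_derive_eq (is_deriveB
    (is_deriveB (is_derive_cst (F i (xstar 0 i)) s 1) d1)
    (is_deriveM (Pd i s s0) d2))).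
  (* The two terms containing [dT i s] cancel, since [f i (T i s) = P i s]. *)
  rewrite fT// /GRing.scale /= -/(Th s) -/(g i s).
  rewrite -[(cst _ - _) s]/(xstar 0 i - T i s); ring.
have Ed (s : R) : 0 <= s -> is_derive s 1 E (dE s).
  move=> s0.
  have dl := is_derive_along _ _ _ _ _ _ (dloss (Th s)) (fun i => Td i s s0).
  have -> : E = id * ((fun s => loss (Th s)) - cst (loss xstar)) + \sum_i B i.
    by apply/funext => x; rewrite fct_sumE.
  apply: (is_derive_eq (is_deriveD (is_deriveM (is_derive_id s 1)
    (is_deriveB dl (is_derive_cst (loss xstar) s 1)))
    (is_derive_sum (fun i => Bd i s s0)))).
  rewrite /dE /GRing.scale /= subr0 mulr1; congr (_ + _).
  by rewrite addrC.
(* The loss gap plus the first-order term at [xstar] is nonpositive by convexity; the remaining term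
   is [s] times the rate of change of the loss. *)
have dE_le0 s : 0 <= s -> dE s <= 0.
  move=> s0; rewrite /dE.
  have H1 := convex_gradient_le _ _ _ (Th s) xstar (dloss _) closs.
  have H2 : s * (\sum_i g i s * dT i s) <= 0.
    by rewrite mulr_ge0_le0// sumr_le0// => i _; exact: gT.
  have H3 : dotr (grad loss (Th s)) (xstar - Th s) =
      \sum_i g i s * (xstar 0 i - T i s).
    apply: eq_bigr => i _.
    by have -> : (xstar - Th s) 0 i = xstar 0 i - T i s by rewrite !mxE.
  by move: H1 H2; rewrite H3; lra.
have [||c + EE] := @MVT_segment R E dE 0 t (ltW t0).
- by move=> x; rewrite in_itv /= => /andP[/ltW x0 _]; exact: Ed.
- apply: derivable_within_continuous => x; rewrite in_itv /= => /andP[x0 _].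
  by have [] := Ed x x0.
rewrite in_itv /= => /andP[c0 _].
have {}EE : E t <= E 0.
  by rewrite -subr_le0 EE subr0 mulr_le0_ge0 ?dE_le0// ltW.
(* The nonnegative divergence at time [t] is dropped from [E t], while [E 0] is exactly the initial
   divergence. *)
rewrite ler_pdivlMr// mulrC (le_trans _ (le_trans EE _))//.
  rewrite /E lerDl BE; last exact: ltW.
  exact: (bregman_separable_ge0 _ _ _ _ dF f_incr).
by rewrite /E mul0r add0r BE.
Qed.

Theorem theorem1 (R : realType) (d L : nat) (hd : (1 <= d)%N) (hL : (2 <= L)%N)
  (loss : 'rV[R]_d -> R) (hloss : forall x, differentiable loss x)
  (u : 'I_L -> R -> 'rV[R]_d) (theta : R -> 'rV[R]_d)
  (htheta : forall t : R, 0 <= t ->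
     theta t = hadamard_prod xpredT (fun j => u j t))
  (hflow : gradient_flow loss u theta)
  (hinit : forall i : 'I_d, exists k : 'I_L,
     argmin (fun l : 'I_L => `|u l 0 0 i|) = [set k]) :
  exists Q : 'rV[R]_d -> R,
    [/\ legendre Q,
        mirror_flow loss Q theta
      & convex_function [set: convex_lmodType 'rV[R]_d] loss ->
        forall thetastar : 'rV[R]_d, argmin loss thetastar ->
        forall t : R, 0 < t ->
          loss (theta t) - loss thetastar
            <= bregman Q thetastar (theta 0) / t].
Proof.
pose g i t := grad loss (theta t) 0 i.
pose slope i j t := - ((\prod_(k | k != j) u k t 0 i) * g i t).
(* Extending with the slope that the flow prescribes at time 0 makes each coordinate differentiable
   on both sides there. *)
pose w i j := extend_left R (fun s => u j s 0 i) (slope i j 0).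
have wE i j s : 0 <= s -> w i j s = u j s 0 i.
  by move=> s0; rewrite /w extend_leftE.
have thetaE s : 0 <= s -> theta s = \row_i \prod_j w i j s.
  move=> s0; rewrite htheta//; apply/rowP => i; rewrite !mxE.
  by apply: eq_bigr => j _; rewrite wE.
have dw i j (t : R) : 0 <= t ->
    is_derive t 1 (w i j) (- ((\prod_(k | k != j) w i k t) * g i t)).
  move=> t0.
  have -> : \prod_(k | k != j) w i k t = \prod_(k | k != j) u k t 0 i.
    by apply: eq_bigr => k _; rewrite wE.
  apply: is_derive_extend_left => // [->//|].
  have /is_time_derivativeP/(_ i) := hflow j t t0.
  by rewrite mxE /hadamard mxE /hadamard_prod mxE.
have /choice[qP qPE] i : exists qP : (R -> R) * (R -> R),
  [/\ continuous qP.1, {homo qP.1 : x y / x < y},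
      forall t, 0 <= t -> qP.1 (\prod_j w i j t) = qP.2 t
    & forall t : R, 0 <= t -> is_derive t 1 qP.2 (- g i t)].
  have [k0 argk0] := hinit i.
  have wmin j : j != k0 -> `|w i k0 0| < `|w i j 0|.
    (* If [j] did no worse than [k0] it would be a minimizer as well, hence equal to [k0]:
       uniqueness of the minimizer yields the strict inequality. *)
    move=> jk; rewrite !wE// ltNge; apply: contra jk => jk; apply/eqP.
    suff : argmin (fun l => `|u l 0 0 i|) j by rewrite argk0.
    move=> l; apply: (le_trans jk); move: l.
    by have : argmin (fun l => `|u l 0 0 i|) k0 by rewrite argk0.
  have [q [P H]] := coordinate_mirror _ _ (w i) (g i) k0 (dw i) wmin.
  by exists (q, P).
pose q i := (qP i).1; pose P i := (qP i).2.
have q_incr i : {homo q i : x y / x < y} by have [] := qPE i.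
have qP_theta i t : 0 <= t -> q i (\prod_j w i j t) = P i t.
  by have [_ _ + _] := qPE i; apply.
have dP i (t : R) : 0 <= t -> is_derive t 1 (P i) (- g i t).
  by have [_ _ _] := qPE i; apply.
have /choice[F dF] i : exists F : R -> R, forall x : R, is_derive x 1 F (q i x).
  by apply: continuous_antiderivative; have [] := qPE i.
exists (fun x => \sum_i F i (x 0 i)); split.
- exact: separable_legendre dF q_incr.
- move=> t t0; apply/is_time_derivativeP => i.
  apply: (is_derive_time_cvg _ _ (P i)) => // [s s0|].
    by rewrite (grad_separable _ _ _ _ dF) mxE thetaE// mxE qP_theta.
  by rewrite mxE; exact: dP.
- move=> closs xstar _ t t0.
  pose T i s := \prod_j w i j s.
  have dT i (s : R) (s0 : 0 <= s) := is_derive_prod _ _ (w i) _ _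
    (fun j => dw i j s s0).
  rewrite (thetaE t (ltW t0)) (thetaE 0)//.
  apply: (mirror_flow_rate _ _ _ F q T P _ _ _ hloss closs dF q_incr dT) => //.
  + by move=> i s s0; rewrite -thetaE//; exact: dP.
  (* Each summand is minus the square of [g i s] times the product over [k != j], so the loss
     dissipates coordinate by coordinate. *)
  + move=> i s s0; rewrite -thetaE// -/(g i s) mulr_sumr sumr_le0// => j _.
    rewrite mulNr mulrN oppr_le0 [_ * g i s]mulrC -mulrA mulrA.
    by rewrite mulr_ge0// -expr2 sqr_ge0.
Qed.
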